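(* Let $G$ and $H$ be Lie groups, let $\Theta:G\to\mathrm{Aut}(H)$ be an action of $G$ on $H$, and let $D:G\to H$ be a crossed homomorphism with respect to $\Theta$. Let $\mathcal D:G\times\mathbb R\to H$ be a deformation of $D$ and put $D_s=\mathcal D(\cdot,s)$. For $s\in\mathbb R$ define $\hat D_s:G\to\mathfrak h$, where $\mathfrak h$ is the Lie algebra of $H$, by $$\hat D_s(a)=(R_{D_s(a)^{-1}})_{*D_s(a)}\frac{d}{dt}\Big|_{t=0}D_{t+s}(a),\qquad a\in G.$$ Then $\hat D_s$ is a $1$-cocycle of the crossed homomorphism $D_s$, i.e. $\hat D_s\in Z^1(D_s)$. Moreover, if $\mathcal D$ and $\mathcal D'$ are equivalent deformations of $D$, then $[\hat D'_0]=[\hat D_0]\in\mathcal H^1(D)$, where $\hat D'_s$ is defined from $\mathcal D'$ in the same way.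
   Context: An action $\Theta:G\to\mathrm{Aut}(H)$ is a (smooth) action of $G$ on $H$ by Lie group automorphisms. A crossed homomorphism with respect to $\Theta$ is a smooth map $D:G\to H$ with $D(ab)=D(a)\cdot(\Theta(a)D(b))$ for all $a,b\in G$. $R_h$ denotes right multiplication by $h$ on $H$, and $(R_h)_{*x}$ its tangent map at $x$. A deformation of $D$ is a smooth map $\mathcal D:G\times\mathbb R\to H$ such that $\mathcal D(\cdot,0)=D$ and $\mathcal D(\cdot,t)$ is a crossed homomorphism with respect to $\Theta$ for every $t\in\mathbb R$. Two deformations $\mathcal D,\mathcal D'$ of $D$ are equivalent (on $I$) if there are an interval $I=(-\varepsilon,\varepsilon)\subset\mathbb R$ and a smooth map $\tau:I\to H$ with $\tau(0)=e_H$ and $\mathcal D(a,t)=\tau(t)\,\mathcal D'(a,t)\,\Theta(a)(\tau(t)^{-1})$ for all $a\in G$, $t\in I$. Cohomology of a crossed homomorphism $D$: with $\tilde\Theta(a)=\Theta(a)_{*e_H}$, the formula $\Theta_D(a)u=\mathrm{Ad}_{D(a)}\tilde\Theta(a)u$ defines a representation of $G$ on $\mathfrak h$. Put $C^0(D)=\mathfrak h$ and, for $k\ge1$, let $C^k(D)$ be the space of smooth maps $G^k\to\mathfrak h$, with differential $$\mathrm d^D\alpha(a_1,\dots,a_{k+1})=\Theta_D(a_1)\alpha(a_2,\dots,a_{k+1})+\sum_{i=1}^k(-1)^i\alpha(a_1,\dots,a_ia_{i+1},\dots,a_{k+1})+(-1)^{k+1}\alpha(a_1,\dots,a_k),$$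 so $\mathrm d^Du(a)=\Theta_D(a)u-u$ for $u\in\mathfrak h$, and $\mathrm d^D\alpha(a,b)=\Theta_D(a)\alpha(b)-\alpha(ab)+\alpha(a)$ for $\alpha\in C^1(D)$. $Z^k(D)$ and $\mathcal H^k(D)$ denote the $k$-cocycles and the $k$-th cohomology group. *)

(* Defs.v *)
From HB Require Import structures.
From mathcomp Require Import all_boot all_order all_algebra.
From mathcomp Require Import all_classical all_reals all_analysis.

Set Implicit Arguments.
Unset Strict Implicit.
Unset Printing Implicit Defensive.

Import Order.TTheory GRing.Theory Num.Theory.
Import numFieldNormedType.Exports.

Local Open Scope classical_set_scope.
Local Open Scope ring_scope.

(* [f] is of class C^k on the open set [U].  The model spaces used below are
   finite-dimensional, where C^{k+1} means differentiable with all directional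
   derivatives of class C^k. *)
Fixpoint Ck (R : realType) (E F : normedModType R) (k : nat)
    (U : set E) (f : E -> F) : Prop :=
  if k is k'.+1 then
    (forall x, U x -> differentiable f x) /\ (forall v, Ck k' U ('D_v f))
  else forall x, U x -> {for x, continuous f}.

Definition Cinfty (R : realType) (E F : normedModType R)
    (U : set E) (f : E -> F) : Prop :=
  forall k, Ck k U f.

(* Only the restriction of [chart_fun] to [chart_dom], and of [chart_inv] to
   [chart_img], is meaningful. *)
Record chart (M E : Type) := Chart {
  chart_dom : set M;
  chart_fun : M -> E;
  chart_inv : E -> M }.

Definition chart_img (M E : Type) (c : chart M E) : set E :=
  chart_fun c @` chart_dom c.

Definition is_chart (R : realType) (M : topologicalType) (E : normedModType R)
    (c : chart M E) : Prop :=
  [/\ open (chart_dom c), open (chart_img c),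
      forall x, chart_dom c x -> chart_inv c (chart_fun c x) = x,
      forall x, chart_dom c x -> {for x, continuous (chart_fun c)} &
      forall v, chart_img c v -> {for v, continuous (chart_inv c)}].

(* [chart_at x] is a preferred chart around [x]: the tangent space at [x] is
   identified with the model space [E] through it. *)
Record charted (M E : Type) := Charted {
  atlas : set (chart M E);
  chart_at : M -> chart M E }.

Definition is_manifold (R : realType) (M : topologicalType)
    (E : normedModType R) (X : charted M E) : Prop :=
  [/\ hausdorff_space M /\ @second_countable M,
      forall c, atlas X c -> is_chart c,
      forall x, atlas X (chart_at X x) /\ chart_dom (chart_at X x) x &
      forall c d, atlas X c -> atlas X d ->
        Cinfty (chart_fun c @` (chart_dom c `&` chart_dom d))
               (chart_fun d \o chart_inv c)].

Definition self_charted (E : Type) : charted E E :=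
  let c := Chart setT id id in Charted [set c] (fun=> c).

Definition prod_chart (M N E F : Type) (c : chart M E) (d : chart N F) :
    chart (M * N) (E * F) :=
  Chart (chart_dom c `*` chart_dom d)
        (fun p => (chart_fun c p.1, chart_fun d p.2))
        (fun q => (chart_inv c q.1, chart_inv d q.2)).

Definition prod_charted (M N E F : Type) (X : charted M E) (Y : charted N F) :
    charted (M * N) (E * F) :=
  Charted [set prod_chart c d | c in atlas X & d in atlas Y]
          (fun p => prod_chart (chart_at X p.1) (chart_at Y p.2)).

Definition smooth_on (R : realType) (M N : topologicalType)
    (E F : normedModType R) (X : charted M E) (Y : charted N F)
    (U : set M) (f : M -> N) : Prop :=
  (forall x, U x -> {for x, continuous f}) /\
  (forall c d, atlas X c -> atlas Y d ->
     Cinfty (chart_fun c @` (U `&` chart_dom c `&` f @^-1` chart_dom d))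
            (chart_fun d \o f \o chart_inv c)).

Definition smooth (R : realType) (M N : topologicalType)
    (E F : normedModType R) (X : charted M E) (Y : charted N F)
    (f : M -> N) : Prop :=
  smooth_on X Y setT f.

(* Tangent map of [f] at [x], read in the preferred charts at [x] and [f x]. *)
Definition tangent_map (R : realType) (M N : topologicalType)
    (E F : normedModType R) (X : charted M E) (Y : charted N F)
    (f : M -> N) (x : M) : E -> F :=
  'd (chart_fun (chart_at Y (f x)) \o f \o chart_inv (chart_at X x))
     (chart_fun (chart_at X x) x).

Definition velocity (R : realType) (M : topologicalType) (E : normedModType R)
    (X : charted M E) (c : R -> M) (t : R) : E :=
  tangent_map (self_charted R) X c t 1.

HB.mixin Record isLieGroup (R : realType) (n : nat) G
    of Group G & Topological G := {
  lie_charted : charted G 'rV[R]_n;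
  lie_manifold : is_manifold lie_charted;
  lie_mul_smooth : smooth (prod_charted lie_charted lie_charted) lie_charted
                     (fun p : G * G => (p.1 * p.2)%g);
  lie_inv_smooth : smooth lie_charted lie_charted (fun x : G => x^-1%g) }.

#[short(type="lieGroupType")]
HB.structure Definition LieGroup (R : realType) (n : nat) :=
  {G of isLieGroup R n G & Group G & Topological G}.

Arguments lie_charted {R n} _.

Section CrossedHomomorphisms.
Context {R : realType} {m n : nat}.
Context {G : lieGroupType R m} {H : lieGroupType R n}.

(* The Lie algebra of [H] is its tangent space at 1, that is ['rV[R]_n] through
   [chart_at (lie_charted H) 1].  The tangent maps at 1 of conjugation and of
   [Theta a], and the one at [x] of right multiplication by [x^-1], land in this
   same space since their base points are sent to 1. *)
Implicit Types (Theta : G -> H -> H) (D : G -> H) (u : 'rV[R]_n).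

Definition lie_action Theta : Prop :=
  [/\ forall h, Theta 1%g h = h,
      forall a b h, Theta (a * b)%g h = Theta a (Theta b h),
      forall a h k, Theta a (h * k)%g = (Theta a h * Theta a k)%g &
      smooth (prod_charted (lie_charted G) (lie_charted H)) (lie_charted H)
        (fun p : G * H => Theta p.1 p.2)].

Definition crossed_hom Theta D : Prop :=
  smooth (lie_charted G) (lie_charted H) D /\
  forall a b, D (a * b)%g = (D a * Theta a (D b))%g.

Definition deformation Theta D (DD : G * R -> H) : Prop :=
  [/\ smooth (prod_charted (lie_charted G) (self_charted R)) (lie_charted H) DD,
      forall a, DD (a, 0) = D a &
      forall t, crossed_hom Theta (fun a => DD (a, t))].

Definition equivalent_deformations Theta (DD DD' : G * R -> H) : Prop :=
  exists eps : R, 0 < eps /\ exists tau : R -> H,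
    [/\ smooth_on (self_charted R) (lie_charted H) `]-eps, eps[ tau,
        tau 0 = 1%g &
        forall a t, - eps < t < eps ->
          DD (a, t) = (tau t * DD' (a, t) * Theta a (tau t)^-1)%g].

Definition lie_tangent_map (f : H -> H) (x : H) : 'rV[R]_n -> 'rV[R]_n :=
  tangent_map (lie_charted H) (lie_charted H) f x.

Definition Ad (h : H) : 'rV[R]_n -> 'rV[R]_n :=
  lie_tangent_map (fun x => (h * x * h^-1)%g) 1%g.

Definition Theta_rep Theta D (a : G) u : 'rV[R]_n :=
  Ad (D a) (lie_tangent_map (Theta a) 1%g u).

Definition cobord0 Theta D u : G -> 'rV[R]_n :=
  fun a => Theta_rep Theta D a u - u.

Definition cobord1 Theta D (alpha : G -> 'rV[R]_n) : G * G -> 'rV[R]_n :=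
  fun p => Theta_rep Theta D p.1 (alpha p.2) - alpha (p.1 * p.2)%g + alpha p.1.

Definition cochain1 : set (G -> 'rV[R]_n) :=
  [set alpha | smooth (lie_charted G) (self_charted 'rV[R]_n) alpha].

Definition cocycle1 Theta D : set (G -> 'rV[R]_n) :=
  [set alpha | cochain1 alpha /\ forall p, cobord1 Theta D alpha p = 0].

(* The class of [alpha] is its coset modulo the coboundaries. *)
Definition cohomology_class Theta D (alpha : G -> 'rV[R]_n) :
    set (G -> 'rV[R]_n) :=
  [set beta | cocycle1 Theta D beta /\
              exists u, forall a, beta a - alpha a = cobord0 Theta D u a].

Definition cohomology1 Theta D : set (set (G -> 'rV[R]_n)) :=
  [set cohomology_class Theta D alpha | alpha in cocycle1 Theta D].

Definition hat (DD : G * R -> H) (s : R) (a : G) : 'rV[R]_n :=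
  lie_tangent_map (fun x => (x * (DD (a, s))^-1)%g) (DD (a, s))
    (velocity (lie_charted H) (fun t => DD (a, t + s)) 0).

End CrossedHomomorphisms.

(* Main.v *)
Require Import Defs.
From HB Require Import structures.
From mathcomp Require Import all_boot all_order all_algebra.
From mathcomp Require Import all_classical all_reals all_analysis.
Import Order.TTheory GRing.Theory Num.Theory.
Import numFieldNormedType.Exports.
Local Open Scope classical_set_scope.
Local Open Scope ring_scope.

Set Implicit Arguments.
Unset Strict Implicit.
Unset Printing Implicit Defensive.

(** Write [F_a t = D_(t+s)(a) * D_s(a)^-1].  By the chain rule [hat DD s a] is
    the velocity at [0] of the curve [F_a], which passes through [1] at time
    [0] ([hatE]).  This puts all the curves of the proof at the identity, where
    the group law is infinitesimally addition ([tangent_map_mulg]) and the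
    inverse is the opposite ([tangent_map_invg]).  Both claims then come from
    differentiating an identity between curves through [1].

    Let [C_a h = D_s(a) * Theta a h * D_s(a)^-1] ([twisted_conj]).  It fixes
    [1], and its tangent map at [1] is the representation [Theta_rep]
    ([Theta_repE]).  The crossed homomorphism law at the times [t + s] and [s]
    gives [F_(ab) t = F_a t * C_a (F_b t)] ([incrementM]), whose derivative at
    [0] is the cocycle identity.  If [tau] realises an equivalence of [DD] with
    [DD'], then at [s = 0] one has [F_a t = tau t * F'_a t * C_a (tau t)^-1] for
    small [t], and the derivative shows that the two cocycles differ by the
    coboundary of the velocity of [tau] at [0] ([hat_equivalent]).

    A cochain must also be smooth.  In charts, [a |-> hat DD s a] is the partial
    derivative in [t] of [(a, t) |-> F_a t], read in the single chart at [1]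
    since all the curves start there ([smooth_velocity]).  That [F] is jointly
    smooth uses that smooth maps compose, hence the chain rule at every order:
    the [v]-derivative of [g \o f] is the sum over a basis of the products of a
    coordinate of the derivative of [f] with a partial derivative of [g] along
    [f], and induction on the order applies to these factors ([Ck_comp]). *)

(** * Differentials *)

Section Differential.
Context {R : realType}.
Implicit Types E F K : normedModType R.

Lemma near_eq_is_diff E F (f g : E -> F) (x : E) :
  (\forall y \near x, f y = g y) -> differentiable f x ->
  is_diff x g ('d f x).
Proof.
move=> fg df.
have h0 : is_diff x (g - f) 0.
  have gfx : (g - f) x = 0 by rewrite !fctE (nbhs_singleton fg) subrr.
  have lit : (g - f) \o shift x = cst ((g - f) x) + (\0 : E -> F) +o_ 0 id.
    apply/eqaddoP => _/posnumP[e]; rewrite gfx.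
    have /= : \forall y \near (0 : E), f (y + x) = g (y + x).
      have := fg; rewrite (near_shift 0 x) /=.
      by apply: filterS => y /=; rewrite subr0.
    apply: filterS => y fgy; rewrite !fctE /= fgy subrr addr0 subr0 normr0.
    by rewrite mulr_ge0.
  have c0 : continuous (\0 : E -> F) by exact: cst_continuous.
  have d0 := diff_unique c0 lit.
  by apply: DiffDef => //; apply/diff_locallyP; rewrite d0.
have -> : g = f + (g - f) by rewrite addrC subrK.
have df' := differentiableP df.
exact: is_diff_eq (is_diffD df' h0) (addr0 _).
Qed.

(** Scaling is a continuous bilinear map, and the differential of such a map is
    given by the Leibniz rule. *)
Lemma is_diff_scale_fun E F (a : E -> R) (f : E -> F) (x : E) :
  differentiable a x -> differentiable f x ->
  is_diff x (fun y => a y *: f y)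
    (fun v => a x *: 'd f x v + 'd a x v *: f x).
Proof.
move=> da df.
have bil : bilinear_for
    (GRing.Scale.Law.clone _ _ *:%R _) (GRing.Scale.Law.clone _ _ *:%R _)
    (fun (k : R) (u : F) => k *: u).
  split=> [u'|u'] b u v /=; first by rewrite scalerDl scalerA.
  by rewrite scalerDr !scalerA mulrC.
pose B : {bilinear R -> F -> F} := HB.pack (fun (k : R) (u : F) => k *: u)
  (bilinear_isBilinear.Build R R F F _ _ _ bil).
have cB : continuous (fun p : R * F => B p.1 p.2).
  by move=> p; exact: scale_continuous.
have dp := is_diff_pair (differentiableP da) (differentiableP df).
have dB : is_diff (a x, f x) (fun p : R * F => B p.1 p.2)
    (fun q => B (a x) q.2 + B q.1 (f x)).
  apply: DiffDef; first exact: differentiable_bilin.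
  by rewrite diff_bilin.
exact: (is_diff_comp dp dB).
Qed.

End Differential.

(** * Functions of class C^k *)

Section CkCalculus.
Context {R : realType}.
Implicit Types E F K : normedModType R.

(** This holds although a derivative at [x] depends on [f] near [x], because the
    set only restricts where conditions are imposed and not the function. Hence
    smoothness in charts may be proved near each point separately, with an
    intermediate chart that depends on the point. *)
Lemma Ck_pointwise E F k (U : set E) (f : E -> F) :
  Ck k U f <-> forall x, U x -> Ck k [set x] f.
Proof.
elim: k f => [|k IH] f /=; first
  by split=> [h x Ux _ ->|h x Ux]; [exact: h|exact: (h x Ux x)].
split=> [[df hf] x Ux|h].
  split=> [_ -> | v]; first exact: df.
  exact: ((IH _).1 (hf v) x Ux).
split=> [x Ux|v]; first by have [+ _] := h x Ux; exact.
by apply/IH => x Ux; have [_ +] := h x Ux; exact.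
Qed.

Lemma Ck_subset E F k (U V : set E) (f : E -> F) :
  U `<=` V -> Ck k V f -> Ck k U f.
Proof. by move=> UV /Ck_pointwise h; apply/Ck_pointwise => x /UV /h. Qed.

Lemma Ck_pred E F k (U : set E) (f : E -> F) : Ck k.+1 U f -> Ck k U f.
Proof.
elim: k f => [|k IH] f; first by case=> df _ x /df /differentiable_continuous.
by move=> [df hf]; split=> // v; apply: IH.
Qed.

Lemma Ck_continuous {E F} k {U : set E} {f : E -> F} (x : E) :
  Ck k U f -> U x -> {for x, continuous f}.
Proof.
by elim: k f => [|k IH] f h Ux; [exact: h|apply: IH (Ck_pred h) Ux].
Qed.

Lemma Ck_eq_on E F k (U : set E) (f g : E -> F) :
  open U -> (forall x, U x -> f x = g x) -> Ck k U f -> Ck k U g.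
Proof.
move=> oU; elim: k f g => [|k IH] f g fg.
  move=> cf x Ux; suff: g @ x --> f x by rewrite (fg x Ux).
  apply: cvg_trans (cf x Ux); apply: near_eq_cvg.
  by have := open_nbhs_nbhs (conj oU Ux); apply: filterS.
have near_fg x : U x -> \forall y \near x, f y = g y.
  by move=> Ux; have := open_nbhs_nbhs (conj oU Ux); apply: filterS.
move=> [df hf]; split=> [x Ux|v].
  by have [] := near_eq_is_diff (near_fg x Ux) (df x Ux).
by apply: IH (hf v) => x /near_fg; exact: near_eq_derive.
Qed.

Lemma Ck_cst E F k (U : set E) (b : F) : Ck k U (fun _ : E => b).
Proof.
elim: k b => [|k IH] b; first by move=> x _; exact: cst_continuous.
split=> [x _|v]; first exact: differentiable_cst.
rewrite (_ : derive _ ^~ v = fun=> 0) //.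
by apply/funext => x; exact: derive_cst.
Qed.

Lemma Ck_add E F k (U : set E) (f g : E -> F) : open U ->
  Ck k U f -> Ck k U g -> Ck k U (fun x => f x + g x).
Proof.
move=> oU; elim: k f g => [|k IH] f g.
  by move=> cf cg x Ux; apply: continuousD; [exact: cf|exact: cg].
move=> [df hf] [dg hg]; split=> [x Ux|v].
  by apply: differentiableD; [exact: df|exact: dg].
apply: Ck_eq_on (IH _ _ (hf v) (hg v)) => // x Ux.
by rewrite [RHS]deriveD //; apply: diff_derivable; [exact: df|exact: dg].
Qed.

Lemma Ck_sum E F k (I : finType) (U : set E) (f : I -> E -> F) : open U ->
  (forall i, Ck k U (f i)) -> Ck k U (fun x => \sum_i f i x).
Proof.
move=> oU hf; elim: index_enum => [|i r IH].
  by rewrite (_ : (fun _ => _) = fun=> 0); [exact: Ck_cst|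
    apply/funext => x; rewrite big_nil].
rewrite (_ : (fun _ => _) = fun x => f i x + \sum_(j <- r) f j x).
  exact: Ck_add.
by apply/funext => x; rewrite big_cons.
Qed.

Lemma Ck_scale E F k (U : set E) (a : E -> R) (f : E -> F) : open U ->
  Ck k U a -> Ck k U f -> Ck k U (fun x => a x *: f x).
Proof.
move=> oU; elim: k a f => [|k IH] a f.
  by move=> ca cf x Ux; apply: continuousZ; [exact: ca|exact: cf].
move=> ha hf; have [[da ha'] [df hf']] := (ha, hf); split=> [x Ux|v].
  by have [] := is_diff_scale_fun (da x Ux) (df x Ux).
apply: (@Ck_eq_on _ _ _ _ (fun x => a x *: 'D_v f x + 'D_v a x *: f x)) => //.
  move=> x Ux; have [dfa e] := is_diff_scale_fun (da x Ux) (df x Ux).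
  by rewrite (deriveE v dfa) e (deriveE v (df x Ux)) (deriveE v (da x Ux)).
apply: (Ck_add oU); first exact: (IH _ _ (Ck_pred ha) (hf' v)).
exact: (IH _ _ (ha' v) (Ck_pred hf)).
Qed.

Lemma Ck_linear E F K k (U : set E) (l : {linear F -> K}) (f : E -> F) :
  continuous l -> open U -> Ck k U f -> Ck k U (fun x => l (f x)).
Proof.
move=> cl oU; elim: k f => [|k IH] f.
  by move=> cf x Ux; apply: continuous_comp; [exact: cf|exact: cl].
move=> [df hf]; have dl y := linear_differentiable y cl.
split=> [x Ux|v]; first by apply: differentiable_comp => //; exact: df.
apply: Ck_eq_on (IH _ (hf v)) => // x Ux.
have dfx := df x Ux.
rewrite [RHS]deriveE; last exact: differentiable_comp.
by rewrite [in RHS]diff_comp // diff_lin //= deriveE.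
Qed.

Lemma Ck_pair E F K k (U : set E) (f : E -> F) (g : E -> K) : open U ->
  Ck k U f -> Ck k U g -> Ck k U (fun x => (f x, g x)).
Proof.
move=> oU; elim: k f g => [|k IH] f g.
  by move=> cf cg x Ux; apply: cvg_pair; [exact: cf|exact: cg].
move=> [df hf] [dg hg]; split=> [x Ux|v].
  by apply: differentiable_pair; [exact: df|exact: dg].
apply: Ck_eq_on (IH _ _ (hf v) (hg v)) => // x Ux.
have [dfx dgx] := (df x Ux, dg x Ux).
by rewrite [RHS]deriveE ?diff_pair ?deriveE //; exact: differentiable_pair.
Qed.

(** Finite-dimensionality, in the form that the chain rule uses: a spanning
    family with continuous coordinate forms. *)
Definition has_coordinates F := exists (I : finType) (e : I -> F)
    (l : I -> {linear F -> R}),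
  (forall i, continuous (l i)) /\ forall x, x = \sum_i l i x *: e i.

(** The [v]-derivative of [g \o f] at [x] is [\sum_i l_i ('D_v f x) *: 'D_(e_i)
    g (f x)], where the [l_i] are the coordinates for the basis [e]. Coordinates
    are essential: the definition of [Ck] controls the derivatives of [g] along
    fixed directions only, whereas the direction ['D_v f x] moves with [x]. *)
Lemma Ck_comp E F K k (U : set E) (V : set F) (f : E -> F) (g : F -> K) :
  has_coordinates F -> open U -> (forall x, U x -> V (f x)) ->
  Ck k U f -> Ck k V g -> Ck k U (g \o f).
Proof.
move=> [I [e [l [cl le]]]] oU UV; elim: k g => [|k IH] g.
  move=> cf cg x Ux; apply: continuous_comp; first exact: cf.
  by apply: cg; apply: UV.
move=> hf hg; have [[df hf'] [dg hg']] := (hf, hg); split=> [x Ux|v].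
  by apply: differentiable_comp; [exact: df|apply: dg; exact: UV].
apply: (@Ck_eq_on _ _ _ _
    (fun x => \sum_i l i ('D_v f x) *: ('D_(e i) g \o f) x)) => //; last first.
  apply: (Ck_sum oU) => i; apply: (Ck_scale oU).
    exact: (Ck_linear (cl i) oU (hf' v)).
  exact: (IH _ (Ck_pred hf) (hg' (e i))).
move=> x Ux; have dfx := df x Ux; have dgx := dg _ (UV _ Ux).
rewrite (deriveE v (differentiable_comp dfx dgx)) diff_comp //=.
rewrite [X in 'd g _ X](le _) linear_sum deriveE //; apply: eq_bigr => i _.
by rewrite linearZ /= deriveE.
Qed.

Lemma Ck_const_linear E F k (U : set E) (l : {linear E -> F}) :
  continuous l -> Ck k U l.
Proof.
move=> cl; case: k => [|k]; first by move=> x _; exact: cl.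
split=> [x _|v]; first exact: linear_differentiable.
rewrite (_ : derive _ ^~ v = fun=> l v); first exact: Ck_cst.
apply/funext => x; rewrite deriveE ?diff_lin //.
exact: linear_differentiable.
Qed.

Lemma has_coordinates_prod E F :
  has_coordinates E -> has_coordinates F -> has_coordinates (E * F)%type.
Proof.
move=> [I [e [l [cl le]]]] [J [e' [l' [cl' le']]]].
pose b (s : I + J) : E * F :=
  match s with inl i => (e i, 0) | inr j => (0, e' j) end.
pose c (s : I + J) : {linear (E * F)%type -> R} :=
  match s with inl i => l i \o fst | inr j => l' j \o snd end.
exists (I + J)%type, b, c; split.
  by case=> i x; apply: continuous_comp;
    [exact: cvg_fst|exact: cl|exact: cvg_snd|exact: cl'].
move=> [x y]; rewrite big_sumType /=.
rewrite (eq_bigr (fun i => (l i x *: e i, 0))); last first.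
  by move=> i _; congr (_, _); exact: scaler0.
rewrite [X in _ = _ + X](eq_bigr (fun i => (0, l' i y *: e' i))); last first.
  by move=> i _; congr (_, _); exact: scaler0.
have sumE (a : I -> E) : \sum_i (a i, 0 : F) = (\sum_i a i, 0).
  by elim: index_enum => [|i r IH]; rewrite ?big_nil // !big_cons IH;
    congr (_, _); rewrite /= addr0.
have sumF (a : J -> F) : \sum_i (0 : E, a i) = (0, \sum_i a i).
  by elim: index_enum => [|i r IH]; rewrite ?big_nil // !big_cons IH;
    congr (_, _); rewrite /= addr0.
by rewrite sumE sumF -le -le'; congr (_, _); rewrite /= ?addr0 ?add0r.
Qed.

Lemma has_coordinates_real : has_coordinates R.
Proof.
exists unit, (fun=> 1), (fun=> idfun); split=> [_|x]; first by move=> x A.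
by rewrite (big_pred1 tt) => [|[]] //=; rewrite [RHS]mulr1.
Qed.

Lemma has_coordinates_row n : has_coordinates 'rV[R]_n.
Proof.
have lin i : linear (fun v : 'rV[R]_n => v 0 i).
  by move=> a u v; rewrite !mxE.
pose l i : {linear 'rV[R]_n -> R} := HB.pack (fun v : 'rV[R]_n => v 0 i)
  (GRing.isLinear.Build _ _ _ _ _ (lin i)).
exists 'I_n, (delta_mx 0), l; split=> [i|x].
  exact: coord_continuous.
exact: row_sum_delta.
Qed.

End CkCalculus.

(** * Charts and smooth maps *)

Section Charts.
Context {R : realType}.
Implicit Types (M N P : topologicalType) (E F K : normedModType R).

(** The part of being a manifold that lets maps be read in charts, kept apart
    from the compatibility of charts so that it passes to product atlases by a
    pointwise argument. *)
Definition has_charts M E (X : charted M E) : Prop :=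
  (forall c, atlas X c -> is_chart c) /\
  forall x, atlas X (chart_at X x) /\ chart_dom (chart_at X x) x.

Lemma manifold_has_charts M E (X : charted M E) :
  is_manifold X -> has_charts X.
Proof. by case. Qed.

Lemma self_has_charts E : has_charts (self_charted E).
Proof.
split=> [_ -> | x] //; split => //=; first exact: openT.
- by rewrite /chart_img /= image_id; exact: openT.
- by move=> x _ A.
- by move=> v _ A.
Qed.

Lemma open_chart_image M E (c : chart M E) (A : set M) :
  is_chart c -> open A -> A `<=` chart_dom c -> open (chart_fun c @` A).
Proof.
move=> [_ oimg cK _ ci] oA sA; rewrite openE => _ [x Ax <-].
have ix : chart_img c (chart_fun c x) by exists x => //; exact: sA.
have nA : nbhs (chart_fun c x) (chart_inv c @^-1` A).
  by apply: (ci _ ix); rewrite cK; [exact: open_nbhs_nbhs|exact: sA].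
have nI := open_nbhs_nbhs (conj oimg ix).
apply: filterS (filterI nI nA) => _ [[z zc <-]] /=.
by rewrite cK // => Az; exists z.
Qed.

Lemma open_prod (M N : topologicalType) (A : set M) (B : set N) :
  open A -> open B -> open (A `*` B).
Proof.
rewrite !openE => oA oB [x y] [/= Ax By]; exists (A, B) => //=.
by split; [exact: oA|exact: oB].
Qed.

Lemma prod_has_charts M N E F (X : charted M E) (Y : charted N F) :
  has_charts X -> has_charts Y -> has_charts (prod_charted X Y).
Proof.
move=> [cX dX] [cY dY]; split; last first.
  move=> [x y] /=; have [[? ?] [? ?]] := (dX x, dY y); split=> //.
  by exists (chart_at X x) => //; exists (chart_at Y y).
move=> _ [c Xc [d Yd <-]].
have [oc oic cK cc ci] := cX c Xc; have [od oid dK dc di] := cY d Yd.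
have img : chart_img (prod_chart c d) = chart_img c `*` chart_img d.
  apply/seteqP; split=> [_ [[x y] [/= ? ?] <-]|].
    by split=> /=; [exists x|exists y].
  by move=> [_ _] [[x ? /= <-] [y ? /= <-]]; exists (x, y).
split=> /=; first exact: open_prod.
- by rewrite img; exact: open_prod.
- by move=> [x y] [/= ? ?]; rewrite cK ?dK.
- move=> [x y] [/= ? ?]; apply: cvg_pair.
    by apply: continuous_comp; [exact: cvg_fst|exact: cc].
  by apply: continuous_comp; [exact: cvg_snd|exact: dc].
- rewrite img => -[u v] [/= ? ?]; apply: cvg_pair.
    by apply: continuous_comp; [exact: cvg_fst|exact: ci].
  by apply: continuous_comp; [exact: cvg_snd|exact: di].
Qed.

Lemma open_smooth_domain M N E F (U : set M) (f : M -> N)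
    (c : chart M E) (d : chart N F) : is_chart c -> is_chart d -> open U ->
  (forall x, U x -> {for x, continuous f}) ->
  open (chart_fun c @` (U `&` chart_dom c `&` f @^-1` chart_dom d)).
Proof.
move=> hc [od _ _ _ _] oU cf; have [oc _ _ _ _] := hc.
apply: (open_chart_image hc); last by move=> x [[]].
rewrite openE => x [[Ux cx] dx]; apply: filterI.
  by apply: filterI; exact: open_nbhs_nbhs.
by apply: (cf x Ux); exact: open_nbhs_nbhs.
Qed.

Lemma smooth_continuous M N E F (X : charted M E) (Y : charted N F) f :
  smooth X Y f -> continuous f.
Proof. by move=> [cf _] x; exact: cf. Qed.

(** Near [x], the composite read in charts factors through the preferred chart
    at [f x], so that the chain rule applies there. *)
Lemma smooth_comp M N P E F K (X : charted M E) (Y : charted N F)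
    (Z : charted P K) (f : M -> N) (g : N -> P) : has_coordinates F ->
  has_charts X -> has_charts Y -> has_charts Z ->
  smooth X Y f -> smooth Y Z g -> smooth X Z (g \o f).
Proof.
move=> cooF hX hY hZ sf sg.
have [cf cg] := (smooth_continuous sf, smooth_continuous sg).
have cgf : continuous (g \o f).
  by move=> x; apply: continuous_comp; [exact: cf|exact: cg].
split=> [x _|c e Xc Ze k]; first exact: cgf.
apply/Ck_pointwise => _ [x [[_ cx] ex] <-].
pose d := chart_at Y (f x); have [Yd dfx] := hY.2 (f x).
have [_ _ cK _ _] := hX.1 c Xc; have [oe _ _ _ _] := hZ.1 e Ze.
have [_ _ dK _ _] := hY.1 d Yd.
pose W := chart_fun c @`
  ((g \o f) @^-1` chart_dom e `&` chart_dom c `&` f @^-1` chart_dom d).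
have oW : open W.
  apply: open_smooth_domain; [exact: hX.1|exact: hY.1| |].
    by apply: open_comp => // y _; exact: cgf.
  by move=> y _; exact: cf.
apply: (@Ck_subset _ _ _ _ _ W); first by move=> _ ->; exists x.
apply: (@Ck_eq_on _ _ _ _ _ ((chart_fun e \o g \o chart_inv d) \o
  (chart_fun d \o f \o chart_inv c)) _ oW).
  by move=> _ [y [[_ cy] dy] <-] /=; rewrite cK // dK.
have h1 := sf.2 c d Xc Yd k; have h2 := sg.2 d e Yd Ze k.
apply: (Ck_comp cooF oW _ (Ck_subset _ h1) h2).
  by move=> _ [y [[ey cy] dy] <-] /=; rewrite cK //; exists (f y).
by move=> _ [y [[ey cy] dy] <-]; exists y.
Qed.

Lemma smooth_pair M N P E F K (X : charted M E) (Y : charted N F)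
    (Z : charted P K) (f : M -> N) (g : M -> P) :
  has_charts X -> has_charts Y -> has_charts Z ->
  smooth X Y f -> smooth X Z g ->
  smooth X (prod_charted Y Z) (fun x => (f x, g x)).
Proof.
move=> hX hY hZ sf sg.
have [cf cg] := (smooth_continuous sf, smooth_continuous sg).
have cfg : continuous (fun x => (f x, g x)).
  by move=> x; apply: cvg_pair; [exact: cf|exact: cg].
split=> [x _|c de Xc YZd k]; first exact: cfg.
have ode := (prod_has_charts hY hZ).1 de YZd.
move: YZd ode => [d Yd [e Ze <-]] ode.
have oW := open_smooth_domain (hX.1 c Xc) ode openT (fun x _ => cfg x).
apply: (Ck_pair oW).
  by apply: Ck_subset (sf.2 c d Xc Yd k) => _ [x [[_ ?] [? ?]] <-]; exists x.
by apply: Ck_subset (sg.2 c e Xc Ze k) => _ [x [[_ ?] [? ?]] <-]; exists x.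
Qed.

Lemma smooth_cst M N E F (X : charted M E) (Y : charted N F) (y : N) :
  smooth X Y (fun=> y).
Proof.
by split=> [x _|c d _ _ k]; [exact: cst_continuous|exact: Ck_cst].
Qed.

Lemma smooth_id M E (X : charted M E) : is_manifold X -> smooth X X id.
Proof.
move=> [_ _ _ tX]; split=> [x _ //|c d Xc Xd k].
by apply: Ck_subset (tX c d Xc Xd k) => _ [x [[_ ?] ?] <-]; exists x.
Qed.

Lemma smooth_self E F (f : E -> F) :
  Cinfty setT f -> smooth (self_charted E) (self_charted F) f.
Proof.
move=> sf; split=> [x _|_ _ -> -> k]; last exact: Ck_subset (sf k).
exact: (Ck_continuous (sf 0%N)).
Qed.

Lemma smooth_fst M N E F (X : charted M E) (Y : charted N F) :
  has_coordinates E -> is_manifold X -> has_charts Y ->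
  smooth (prod_charted X Y) X fst.
Proof.
move=> cooE mX hY; have hX := manifold_has_charts mX; have [_ _ _ tX] := mX.
have cfst : continuous (@fst M N) by move=> p; exact: cvg_fst.
split=> [p _|_ c' [c Xc [d Yd <-]] Xc' k]; first exact: cfst.
have oW := open_smooth_domain ((prod_has_charts hX hY).1 (prod_chart c d)
  (ex_intro2 _ _ c Xc (ex_intro2 _ _ d Yd erefl))) (hX.1 c' Xc') openT
  (fun p _ => cfst p).
have lfst : continuous (fst : {linear (E * F)%type -> E}).
  by move=> p; exact: cvg_fst.
apply: (Ck_comp cooE oW _ (Ck_const_linear _ _ lfst) (tX c c' Xc Xc' k)).
by move=> _ [[x y] [[_ [/= ? ?]] /= ?] <-]; exists x.
Qed.

End Charts.

(** * Tangent maps *)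

Section Tangent.
Context {R : realType}.
Implicit Types (M N P : topologicalType) (E F K : normedModType R).

(** Continuity is included because differentiability of the map read in charts
    does not give it: a chart at [f x] says nothing about the values of [f]
    outside its domain. *)
Definition mdiff M N E F (X : charted M E) (Y : charted N F) (f : M -> N)
    (x : M) : Prop :=
  {for x, continuous f} /\
  differentiable (chart_fun (chart_at Y (f x)) \o f \o chart_inv (chart_at X x))
    (chart_fun (chart_at X x) x).

Lemma tangent_mapD M N E F (X : charted M E) (Y : charted N F) (f : M -> N) x
    u v : tangent_map X Y f x (u + v) =
  tangent_map X Y f x u + tangent_map X Y f x v.
Proof. exact: linearD. Qed.

Lemma tangent_mapN M N E F (X : charted M E) (Y : charted N F) (f : M -> N) x
    v : tangent_map X Y f x (- v) = - tangent_map X Y f x v.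
Proof. exact: linearN. Qed.

Lemma smooth_on_mdiff M N E F (X : charted M E) (Y : charted N F)
    (U : set M) (f : M -> N) (x : M) : has_charts X -> has_charts Y ->
  smooth_on X Y U f -> U x -> mdiff X Y f x.
Proof.
move=> hX hY [cf sf] Ux; have [Xc cx] := hX.2 x; have [Yd dx] := hY.2 (f x).
split; first exact: cf.
by have [df _] := sf _ _ Xc Yd 1%N; apply: df; exists x.
Qed.

Lemma smooth_mdiff M N E F (X : charted M E) (Y : charted N F) (f : M -> N) x :
  has_charts X -> has_charts Y -> smooth X Y f -> mdiff X Y f x.
Proof. by move=> hX hY sf; exact: (smooth_on_mdiff hX hY sf). Qed.

Lemma chart_inv_cvg M E (X : charted M E) (x : M) : has_charts X ->
  chart_inv (chart_at X x) v @[v --> chart_fun (chart_at X x) x] --> x.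
Proof.
move=> [hX dX]; have [Xc cx] := dX x; have [_ _ cK _ ci] := hX _ Xc.
have := ci _ (imageP (chart_fun (chart_at X x)) cx).
by rewrite /prop_for /continuous_at cK.
Qed.

(** The two factors read in charts compose to the composite read in charts only
    near [x], where [f] takes its values in the domain of the chart at [f x]. *)
Lemma is_diff_comp_chart M N P E F K (X : charted M E) (Y : charted N F)
    (Z : charted P K) (f : M -> N) (g : N -> P) (x : M) :
  has_charts X -> has_charts Y -> mdiff X Y f x -> mdiff Y Z g (f x) ->
  is_diff (chart_fun (chart_at X x) x)
    (chart_fun (chart_at Z (g (f x))) \o (g \o f) \o chart_inv (chart_at X x))
    (tangent_map Y Z g (f x) \o tangent_map X Y f x).
Proof.
move=> hX hY [cf df] [cg dg].
have [Xc cx] := hX.2 x; have [_ _ cK _ _] := hX.1 _ Xc.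
have [Yd dfx] := hY.2 (f x); have [od _ dK _ _] := hY.1 _ Yd.
have fx : (chart_fun (chart_at Y (f x)) \o f \o chart_inv (chart_at X x))
   (chart_fun (chart_at X x) x) = chart_fun (chart_at Y (f x)) (f x).
  by rewrite /= cK.
move: dg; rewrite -fx => dg.
have dgf := differentiable_comp df dg.
apply: is_diff_eq (near_eq_is_diff _ dgf) _; last first.
  by rewrite (diff_comp df dg) fx.
have nd : nbhs (f x) (chart_dom (chart_at Y (f x))) by exact: open_nbhs_nbhs.
have : \forall v \near chart_fun (chart_at X x) x,
    chart_dom (chart_at Y (f x)) (f (chart_inv (chart_at X x) v)).
  exact: (chart_inv_cvg hX (cf _ nd)).
by apply: filterS => v dv /=; rewrite dK.
Qed.

Lemma mdiff_comp M N P E F K (X : charted M E) (Y : charted N F)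
    (Z : charted P K) (f : M -> N) (g : N -> P) (x : M) :
  has_charts X -> has_charts Y -> mdiff X Y f x -> mdiff Y Z g (f x) ->
  mdiff X Z (g \o f) x.
Proof.
move=> hX hY df dg; split.
  by apply: continuous_comp; [exact: df.1|exact: dg.1].
by have [] := is_diff_comp_chart hX hY df dg.
Qed.

Lemma tangent_map_comp M N P E F K (X : charted M E) (Y : charted N F)
    (Z : charted P K) (f : M -> N) (g : N -> P) (x : M) :
  has_charts X -> has_charts Y -> mdiff X Y f x -> mdiff Y Z g (f x) ->
  tangent_map X Z (g \o f) x = tangent_map Y Z g (f x) \o tangent_map X Y f x.
Proof.
by move=> hX hY df dg; have [_ e] := is_diff_comp_chart hX hY df dg; exact: e.
Qed.

Lemma mdiff_pair M N P E F K (X : charted M E) (Y : charted N F)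
    (Z : charted P K) (f : M -> N) (g : M -> P) (x : M) :
  mdiff X Y f x -> mdiff X Z g x ->
  mdiff X (prod_charted Y Z) (fun y => (f y, g y)) x.
Proof.
move=> [cf df] [cg dg]; split; first exact: cvg_pair.
exact: differentiable_pair df dg.
Qed.

Lemma tangent_map_pair M N P E F K (X : charted M E) (Y : charted N F)
    (Z : charted P K) (f : M -> N) (g : M -> P) (x : M) (v : E) :
  mdiff X Y f x -> mdiff X Z g x ->
  tangent_map X (prod_charted Y Z) (fun y => (f y, g y)) x v =
    (tangent_map X Y f x v, tangent_map X Z g x v).
Proof.
move=> [_ df] [_ dg]; rewrite /tangent_map -[RHS]/((fun v => (_ v, _ v)) v).
by rewrite -(diff_pair df dg).
Qed.

Lemma mdiff_cst M N E F (X : charted M E) (Y : charted N F) (y : N) x :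
  mdiff X Y (fun=> y) x.
Proof. by split; [exact: cst_continuous|exact: differentiable_cst]. Qed.

Lemma tangent_map_cst M N E F (X : charted M E) (Y : charted N F) (y : N) x :
  tangent_map X Y (fun=> y) x = 0.
Proof. exact: diff_cst. Qed.

Lemma is_diff_id_chart M E (X : charted M E) x : has_charts X ->
  is_diff (chart_fun (chart_at X x) x)
    (chart_fun (chart_at X x) \o id \o chart_inv (chart_at X x)) id.
Proof.
move=> hX; have [Xc cx] := hX.2 x; have [_ oi cK _ _] := hX.1 _ Xc.
set u := chart_fun _ _; have [did eid] := is_diff_id u.
apply: is_diff_eq (near_eq_is_diff _ did) eid.
have : nbhs u (chart_img (chart_at X x)).
  by apply: open_nbhs_nbhs; split=> //; exists x.
by apply: filterS => _ [y cy <-] /=; rewrite cK.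
Qed.

Lemma mdiff_id M E (X : charted M E) x : has_charts X -> mdiff X X id x.
Proof. by move=> hX; split=> //; have [] := is_diff_id_chart x hX. Qed.

Lemma tangent_map_id M E (X : charted M E) x : has_charts X ->
  tangent_map X X id x = id.
Proof. by move=> hX; have [_ e] := is_diff_id_chart x hX; exact: e. Qed.

Lemma tangent_map_near_eq M N E F (X : charted M E) (Y : charted N F)
    (f g : M -> N) (x : M) : has_charts X ->
  (\forall y \near x, f y = g y) -> mdiff X Y f x ->
  tangent_map X Y g x = tangent_map X Y f x.
Proof.
move=> hX fg [cf df]; rewrite /tangent_map -(nbhs_singleton fg).
have [] // := @near_eq_is_diff _ _ _ _ (chart_fun (chart_at Y (f x)) \o g
  \o chart_inv (chart_at X x)) _ _ df.
have : \forall v \near chart_fun (chart_at X x) x,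
  f (chart_inv (chart_at X x) v) = g (chart_inv (chart_at X x) v).
  exact: (chart_inv_cvg hX fg).
by apply: filterS => v /= ->.
Qed.

End Tangent.

(** * Velocities depending on a parameter *)

Section SmoothVelocity.
Context {R : realType}.
Implicit Types (M N : topologicalType) (E F : normedModType R).

(** Since all the curves [f (x, _)] start at the same point [y], their
    velocities are read in one chart, and there they are the partial derivative
    of the jointly smooth map [f] in its second variable, restricted to time
    [0]. *)
Lemma smooth_velocity M N E F (X : charted M E) (Y : charted N F)
    (f : M * R -> N) (y : N) :
  has_coordinates E -> has_charts X -> has_charts Y ->
  smooth (prod_charted X (self_charted R)) Y f -> (forall x, f (x, 0) = y) ->
  smooth X (self_charted F) (fun x => velocity Y (fun t => f (x, t)) 0).
Proof.
move=> cooE hX hY sf fy; set h := fun x => _.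
pose phi := chart_fun (chart_at Y y); have [Yd dy] := hY.2 y.
have hXR := prod_has_charts hX (self_has_charts R).
have smooth_chart c : atlas X c -> Cinfty (chart_img c) (h \o chart_inv c).
  move=> Xc k; have [oc oi cK _ _] := hX.1 c Xc.
  pose ct := prod_chart c (Chart setT id id : chart R R).
  have XRct : atlas (prod_charted X (self_charted R)) ct.
    by exists c => //; exists (Chart setT id id).
  pose g := phi \o f \o chart_inv ct.
  pose W := chart_fun ct @`
    (setT `&` chart_dom ct `&` f @^-1` chart_dom (chart_at Y y)).
  have gW : Cinfty W g by exact: (sf.2 ct _ XRct Yd).
  have imgW u : chart_img c u -> W (u, 0).
    by move=> [x cx <-]; exists (x, 0) => //; split=> //=; rewrite fy.
  have Ck_incl : Ck k (chart_img c) (fun u => (u, 0 : R)).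
    apply: (Ck_pair oi); last exact: Ck_cst.
    by apply: (@Ck_const_linear _ _ _ _ _ idfun) => x A.
  have Dg : Ck k W ('D_((0 : E, 1 : R)) g) by have [_] := gW k.+1; exact.
  have cooER := has_coordinates_prod cooE (@has_coordinates_real R).
  apply: Ck_eq_on (Ck_comp cooER oi imgW Ck_incl Dg) => // u ciu /=.
  have [dg _] := gW 1%N; have dgu := dg _ (imgW u ciu).
  rewrite (deriveE _ dgu).
  have dcu := differentiable_cst u (0 : R).
  have [did eid] := is_diff_id (0 : R).
  have dpair := differentiable_pair dcu did.
  transitivity ('d (g \o (fun t : R => (cst u t, id t))) (0 : R) 1).
    by rewrite (diff_comp dpair dgu) /= (diff_pair dcu did) diff_cst eid.
  by rewrite /h /velocity /tangent_map /= fy.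
split=> [x _|c _ Xc -> k].
  have [Xc cx] := hX.2 x; have [oc _ cK cc _] := hX.1 _ Xc.
  set c := chart_at X x in Xc cx oc cK cc.
  have ch : {for chart_fun c x, continuous (h \o chart_inv c)}.
    by apply: (Ck_continuous (smooth_chart c Xc 0%N)); exists x.
  have chc : {for x, continuous ((h \o chart_inv c) \o chart_fun c)}.
    by apply: continuous_comp; [exact: cc|exact: ch].
  suff: h @ x --> ((h \o chart_inv c) \o chart_fun c) x by rewrite /= cK.
  apply: cvg_trans chc; apply: near_eq_cvg.
  by have := open_nbhs_nbhs (conj oc cx); apply: filterS => z cz /=;
    rewrite cK.
by apply: Ck_subset (smooth_chart c Xc k) => _ [x [[_ ?] _] <-]; exists x.
Qed.

End SmoothVelocity.

(** * The tangent map of the group law at the identity *)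

Section LieGroupCalculus.
Context {R : realType} {n : nat} {H : lieGroupType R n}.
Context {M : topologicalType} {E : normedModType R} (Y : charted M E).
Hypothesis hY : has_charts Y.
Local Notation X := (lie_charted H).
Implicit Types (f g : M -> H) (x : M) (v : E).

Lemma lie_has_charts : has_charts X.
Proof. exact: manifold_has_charts lie_manifold. Qed.
Let hX := lie_has_charts.
Let cooX := @has_coordinates_row R n.

Lemma smooth_mulg f g :
  smooth Y X f -> smooth Y X g -> smooth Y X (fun x => (f x * g x)%g).
Proof.
move=> sf sg; have hXX := prod_has_charts hX hX.
exact: (smooth_comp (has_coordinates_prod cooX cooX) hY hXX hX
  (smooth_pair hY hX hX sf sg) lie_mul_smooth).
Qed.

Lemma smooth_invg f : smooth Y X f -> smooth Y X (fun x => (f x)^-1%g).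
Proof. by move=> sf; exact: (smooth_comp cooX hY hX hX sf lie_inv_smooth). Qed.

Lemma mdiff_mul (p : H * H) :
  mdiff (prod_charted X X) X (fun p : H * H => (p.1 * p.2)%g) p.
Proof.
exact: (smooth_mdiff _ (prod_has_charts hX hX) hX lie_mul_smooth).
Qed.

Lemma mdiff_mulg f g x :
  mdiff Y X f x -> mdiff Y X g x -> mdiff Y X (fun y => (f y * g y)%g) x.
Proof.
move=> df dg.
exact: (mdiff_comp hY (prod_has_charts hX hX) (mdiff_pair df dg) (mdiff_mul _)).
Qed.

Lemma mdiff_invg f x : mdiff Y X f x -> mdiff Y X (fun y => (f y)^-1%g) x.
Proof.
move=> df.
exact: (mdiff_comp hY hX df (smooth_mdiff _ hX hX lie_inv_smooth)).
Qed.

(** By linearity it suffices to treat [(p, 0)] and [(0, q)], the images of [p]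
    and [q] under the tangent maps of [z |-> (z, 1)] and [z |-> (1, z)].
    Followed by multiplication, each of these two maps is the identity. *)
Lemma tangent_map_mul1 (p q : 'rV[R]_n) :
  tangent_map (prod_charted X X) X (fun p : H * H => (p.1 * p.2)%g)
    (1%g, 1%g) (p, q) = p + q.
Proof.
have hXX := prod_has_charts hX hX.
have did := mdiff_id (1%g : H) hX.
have dcst := mdiff_cst X X (1%g : H) (1%g : H).
have -> : (p, q) = (p, 0) + (0, q) by congr (_, _); rewrite /= ?addr0 ?add0r.
rewrite tangent_mapD; congr (_ + _).
  have := tangent_map_comp hX hXX (mdiff_pair did dcst) (mdiff_mul _).
  move=> /(congr1 (fun h : 'rV[R]_n -> 'rV[R]_n => h p)) /=.
  rewrite (tangent_map_pair _ did dcst) tangent_map_id // tangent_map_cst /=.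
  move=> <-; rewrite (_ : _ \o _ = id) ?tangent_map_id //.
  by apply/funext => z /=; rewrite mulg1.
have := tangent_map_comp hX hXX (mdiff_pair dcst did) (mdiff_mul _).
move=> /(congr1 (fun h : 'rV[R]_n -> 'rV[R]_n => h q)) /=.
rewrite (tangent_map_pair _ dcst did) tangent_map_id // tangent_map_cst /=.
move=> <-; rewrite (_ : _ \o _ = id) ?tangent_map_id //.
by apply/funext => z /=; rewrite mul1g.
Qed.

Lemma tangent_map_mulg f g x v : mdiff Y X f x -> mdiff Y X g x ->
  f x = 1%g -> g x = 1%g ->
  tangent_map Y X (fun y => (f y * g y)%g) x v =
    tangent_map Y X f x v + tangent_map Y X g x v.
Proof.
move=> df dg fx gx; have hXX := prod_has_charts hX hX.
have := tangent_map_comp hY hXX (mdiff_pair df dg) (mdiff_mul _).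
move=> /(congr1 (fun h : E -> 'rV[R]_n => h v)) /=.
by rewrite (tangent_map_pair _ df dg) fx gx tangent_map_mul1.
Qed.

(** The product of [f] with its inverse is constant, so the two tangent maps add
    up to zero. *)
Lemma tangent_map_invg f x v : mdiff Y X f x -> f x = 1%g ->
  tangent_map Y X (fun y => (f y)^-1%g) x v = - tangent_map Y X f x v.
Proof.
move=> df fx; apply/eqP; rewrite -addr_eq0 addrC; apply/eqP.
rewrite -(tangent_map_mulg _ df (mdiff_invg df) fx); last by rewrite fx invg1.
rewrite (_ : (fun y => _) = fun=> 1%g) ?tangent_map_cst //.
by apply/funext => y; rewrite mulgV.
Qed.

End LieGroupCalculus.

(** * The representation on the Lie algebra *)

Section TwistedConjugation.
Context {R : realType} {m n : nat}.
Context {G : lieGroupType R m} {H : lieGroupType R n}.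
Variables (Theta : G -> H -> H) (D : G -> H).
Hypothesis hTheta : lie_action Theta.
Local Notation X := (lie_charted H).
Let hG : has_charts (lie_charted G) := lie_has_charts.
Let hX : has_charts X := lie_has_charts.

(** The automorphism of [H] whose tangent map at [1] is [Theta_rep]. *)
Definition twisted_conj (a : G) (h : H) : H := (D a * Theta a h * (D a)^-1)%g.

Lemma action1 a : Theta a 1%g = 1%g.
Proof.
have [_ _ hM _] := hTheta.
by apply: (mulgI (Theta a 1%g)); rewrite -hM !mulg1.
Qed.

Lemma actionV a h : Theta a h^-1%g = (Theta a h)^-1%g.
Proof.
have [_ _ hM _] := hTheta.
by apply: (mulgI (Theta a h)); rewrite -hM !mulgV action1.
Qed.

Lemma twisted_conj1 a : twisted_conj a 1%g = 1%g.
Proof. by rewrite /twisted_conj action1 mulg1 mulgV. Qed.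

Lemma smooth_conj (h : H) : smooth X X (fun x : H => (h * x * h^-1)%g).
Proof.
apply: (smooth_mulg hX _ (smooth_cst _ _ _)).
exact: (smooth_mulg hX (smooth_cst _ _ _) (smooth_id lie_manifold)).
Qed.

Lemma smooth_action a : smooth X X (Theta a).
Proof.
have [_ _ _ sT] := hTheta.
exact: (smooth_comp (has_coordinates_prod (@has_coordinates_row R m)
  (@has_coordinates_row R n)) hX (prod_has_charts hG hX) hX
  (smooth_pair hX hG hX (smooth_cst _ _ a) (smooth_id lie_manifold)) sT).
Qed.

Lemma mdiff_twisted_conj a h : mdiff X X (twisted_conj a) h.
Proof.
apply: (smooth_mdiff _ hX hX).
exact: (smooth_comp (@has_coordinates_row R n) hX hX hX (smooth_action a)
  (smooth_conj (D a))).
Qed.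

Lemma Theta_repE a u :
  Theta_rep Theta D a u = tangent_map X X (twisted_conj a) 1%g u.
Proof.
have dT := smooth_mdiff (1%g : H) hX hX (smooth_action a).
have dc := smooth_mdiff (Theta a 1%g) hX hX (smooth_conj (D a)).
have := tangent_map_comp hX hX dT dc.
move=> /(congr1 (fun h : 'rV[R]_n -> 'rV[R]_n => h u)) /= ->.
by rewrite action1.
Qed.

Lemma Theta_repD a u v :
  Theta_rep Theta D a (u + v) = Theta_rep Theta D a u + Theta_rep Theta D a v.
Proof. by rewrite /Theta_rep /Ad /lie_tangent_map 2!tangent_mapD. Qed.

Lemma Theta_repN a u : Theta_rep Theta D a (- u) = - Theta_rep Theta D a u.
Proof. by rewrite /Theta_rep /Ad /lie_tangent_map 2!tangent_mapN. Qed.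

Lemma tangent_map_twisted_conj (M : topologicalType)
    (E : normedModType R) (Y : charted M E) (f : M -> H) (x : M) v a :
  has_charts Y -> mdiff Y X f x -> f x = 1%g ->
  tangent_map Y X (fun y => twisted_conj a (f y)) x v =
    Theta_rep Theta D a (tangent_map Y X f x v).
Proof.
move=> hY df fx; rewrite Theta_repE -fx.
by rewrite (tangent_map_comp hY hX df (mdiff_twisted_conj a _)).
Qed.

Lemma cobord0D u v a :
  cobord0 Theta D (u + v) a = cobord0 Theta D u a + cobord0 Theta D v a.
Proof. by rewrite /cobord0 Theta_repD opprD addrACA. Qed.

Lemma cobord0N u a : cobord0 Theta D (- u) a = - cobord0 Theta D u a.
Proof. by rewrite /cobord0 Theta_repN opprD. Qed.

End TwistedConjugation.

(** * The curve whose velocity is the cocycle *)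

Section Increment.
Context {R : realType} {m n : nat}.
Context {G : lieGroupType R m} {H : lieGroupType R n}.
Variable DD : G * R -> H.
Hypothesis sDD :
  smooth (prod_charted (lie_charted G) (self_charted R)) (lie_charted H) DD.
Local Notation X := (lie_charted H).
Local Notation SR := (self_charted R).
Let hG : has_charts (lie_charted G) := lie_has_charts.
Let hX : has_charts X := lie_has_charts.
Let hR : has_charts SR := self_has_charts R.
Let hGR := prod_has_charts hG hR.
Let cooGR := has_coordinates_prod (@has_coordinates_row R m)
  (@has_coordinates_real R).

(** The curve [t |-> DD (a, t + s)] translated so that it passes through [1] at
    time [0]; [a] remains a variable because the velocity must be smooth in it.
    *)
Definition increment (s : R) (p : G * R) : H :=
  (DD (p.1, p.2 + s) * (DD (p.1, s))^-1)%g.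

Lemma increment0 s a : increment s (a, 0) = 1%g.
Proof. by rewrite /increment /= add0r mulgV. Qed.

Lemma smooth_increment s :
  smooth (prod_charted (lie_charted G) SR) X (increment s).
Proof.
have sfst := smooth_fst (@has_coordinates_row R m) (@lie_manifold R m G) hR.
have ssnd : smooth (prod_charted (lie_charted G) SR) SR (fun p => p.2 + s).
  split=> [p _|_ _ [c Gc [_ -> <-]] -> k /=].
    apply: continuousD; [exact: cvg_snd|exact: cst_continuous].
  have [_ oc _ _ _] := hGR.1 (prod_chart c (Chart setT id id : chart R R))
    (ex_intro2 _ _ c Gc (ex_intro2 _ _ (Chart setT id id) erefl erefl)).
  have csnd : continuous (snd : {linear ('rV[R]_m * R)%type -> R}).
    by move=> q; exact: cvg_snd.
  apply: Ck_subset (Ck_add oc (Ck_const_linear _ _ csnd) (Ck_cst _ _ s)).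
  by move=> _ [p [[_ dp] _] <-]; exists p.
apply: (smooth_mulg hGR).
  exact: (smooth_comp cooGR hGR hGR hX (smooth_pair hGR hG hR sfst ssnd) sDD).
apply: (smooth_invg hGR).
exact: (smooth_comp cooGR hGR hGR hX
  (smooth_pair hGR hG hR sfst (smooth_cst _ _ s)) sDD).
Qed.

Lemma smooth_curve (f : G * R -> H) a :
  smooth (prod_charted (lie_charted G) SR) X f ->
  smooth SR X (fun t => f (a, t)).
Proof.
have sid : smooth SR SR id.
  apply: smooth_self => k.
  by apply: (@Ck_const_linear _ _ _ _ _ idfun) => x A.
exact: (smooth_comp cooGR hR hGR hX
  (smooth_pair hR hG hR (smooth_cst _ _ a) sid)).
Qed.

Lemma mdiff_increment s a t : mdiff SR X (fun t => increment s (a, t)) t.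
Proof.
exact: (smooth_mdiff _ hR hX (smooth_curve a (smooth_increment s))).
Qed.

(** The chain rule for the curve [t |-> DD (a, t + s)] followed by the right
    translation by [(DD (a, s))^-1]. *)
Lemma hatE s a : hat DD s a = velocity X (fun t => increment s (a, t)) 0.
Proof.
have dc : mdiff SR X (fun t => DD (a, t + s)) 0.
  rewrite (_ : (fun t => _) = fun t => (increment s (a, t) * DD (a, s))%g).
    exact: (mdiff_mulg hR (mdiff_increment _ _ _) (mdiff_cst _ _ _ _)).
  by apply/funext => t; rewrite /increment mulgVK.
have sr : smooth X X (fun x => x * (DD (a, s))^-1)%g.
  exact: (smooth_mulg hX (smooth_id lie_manifold) (smooth_cst _ _ _)).
have dr := smooth_mdiff (DD (a, 0 + s)) hX hX sr.
rewrite /velocity (tangent_map_comp hR hX dc dr) /= add0r.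
by [].
Qed.

Lemma smooth_hat s : cochain1 (hat DD s).
Proof.
rewrite (_ : hat DD s = fun a => velocity X (fun t => increment s (a, t)) 0).
  exact: (smooth_velocity (@has_coordinates_row R m) hG hX (smooth_increment s)
    (increment0 s)).
by apply/funext => a; exact: hatE.
Qed.

End Increment.

(** * Cocycle identity and equivalent deformations *)

Section Deformation.
Context {R : realType} {m n : nat}.
Context {G : lieGroupType R m} {H : lieGroupType R n}.
Variables (Theta : G -> H -> H) (D : G -> H).
Hypothesis hTheta : lie_action Theta.
Local Notation X := (lie_charted H).
Local Notation SR := (self_charted R).
Let hX : has_charts X := lie_has_charts.
Let hR : has_charts SR := self_has_charts R.

Lemma incrementM (DD : G * R -> H) s a b t :
  crossed_hom Theta (fun a => DD (a, s)) ->
  crossed_hom Theta (fun a => DD (a, t + s)) ->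
  increment DD s ((a * b)%g, t) = (increment DD s (a, t) *
    twisted_conj Theta (fun a => DD (a, s)) a (increment DD s (b, t)))%g.
Proof.
move=> [_ Ms] [_ Mt]; have [_ _ hM _] := hTheta.
rewrite /increment /twisted_conj /= Mt Ms hM (actionV hTheta) invgM.
by rewrite !mulgA mulgVK.
Qed.

(** The derivative at [0] of [incrementM]. *)
Lemma hat_cocycle DD s : deformation Theta D DD ->
  cocycle1 Theta (fun a => DD (a, s)) (hat DD s).
Proof.
move=> [sDD _ cDD]; split=> [|[a b]]; first exact: smooth_hat.
have dF c := mdiff_increment sDD s c 0.
have dC : mdiff SR X (fun t => twisted_conj Theta (fun a => DD (a, s)) a
    (increment DD s (b, t))) 0.
  exact: (mdiff_comp hR hX (dF b) (mdiff_twisted_conj _ hTheta a _)).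
have hatM : hat DD s (a * b)%g =
    hat DD s a + Theta_rep Theta (fun a => DD (a, s)) a (hat DD s b).
  have C0 : twisted_conj Theta (fun a => DD (a, s)) a (increment DD s (b, 0))
      = 1%g by rewrite increment0 (twisted_conj1 _ hTheta).
  have eM := tangent_map_mulg hR 1 (dF a) dC (increment0 _ _ _) C0.
  have eC := tangent_map_twisted_conj (fun a => DD (a, s)) hTheta (1 : R) a hR
    (dF b) (increment0 _ _ _).
  rewrite !(hatE sDD) /velocity -[X in _ = _ + X]eC -[RHS]eM.
  have -> // : (fun t => increment DD s ((a * b)%g, t)) =
      (fun t => increment DD s (a, t) *
        twisted_conj Theta (fun a => DD (a, s)) a (increment DD s (b, t)))%g.
  apply/funext => t.
  exact: incrementM (cDD s) (cDD (t + s)).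
by rewrite /cobord1 /= hatM addrAC [X in X - _]addrC subrr.
Qed.

(** For small [t] one has [F_a t = tau t * F'_a t * C_a (tau t)^-1]. With [w]
    the velocity of [tau] at [0], the derivative at [0] of this identity is [hat
    DD 0 a = w + hat DD' 0 a - Theta_rep Theta D a w]. *)
Lemma hat_equivalent DD DD' :
  deformation Theta D DD -> deformation Theta D DD' ->
  equivalent_deformations Theta DD DD' ->
  exists w, forall a, hat DD' 0 a - hat DD 0 a = cobord0 Theta D w a.
Proof.
move=> [sDD D0 cDD] [sDD' D0' cDD'] [eps [eps0 [tau [stau tau0 e]]]].
have in0 : [set` `]-eps, eps[] (0 : R) by rewrite /= in_itv /= oppr_lt0 eps0.
have dtau := smooth_on_mdiff hR hX stau in0.
exists (velocity X tau 0) => a.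
have dF := mdiff_increment sDD 0 a 0.
have dF' := mdiff_increment sDD' 0 a 0.
have dV := mdiff_invg hR dtau.
have tauV0 : (tau 0)^-1%g = 1%g by rewrite tau0 invg1.
have dC : mdiff SR X (fun t => twisted_conj Theta D a (tau t)^-1%g) 0.
  exact: (mdiff_comp hR hX dV (mdiff_twisted_conj _ hTheta a _)).
have C0 : twisted_conj Theta D a (tau 0)^-1%g = 1%g.
  by rewrite tauV0 twisted_conj1.
pose P t := (tau t * increment DD' 0 (a, t) *
  twisted_conj Theta D a (tau t)^-1)%g.
have dtF := mdiff_mulg hR dtau dF'.
have near_P : \forall t \near (0 : R), increment DD 0 (a, t) = P t.
  have : \forall t \near (0 : R), t \in `]-eps, eps[ by exact: near_in_itvoo.
  apply: filterS => t; rewrite in_itv /= => te.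
  (* Both deformations restrict to [D] at time [0], so the normalising factors
     [D(a)^-1] agree. *)
  rewrite /P /increment /twisted_conj /= !addr0 e // D0 D0'.
  by rewrite !mulgA mulgVK.
have -> : hat DD 0 a = velocity X tau 0 + hat DD' 0 a
    - Theta_rep Theta D a (velocity X tau 0).
  rewrite (hatE sDD) (hatE sDD') /velocity -(tangent_map_near_eq hR near_P dF).
  have tF0 : (tau 0 * increment DD' 0 (a, 0))%g = 1%g.
    by rewrite tau0 increment0 mul1g.
  rewrite (tangent_map_mulg hR 1 dtF dC tF0 C0).
  rewrite (tangent_map_mulg hR 1 dtau dF' tau0 (increment0 _ _ _)).
  rewrite (tangent_map_twisted_conj D hTheta (1 : R) a hR dV tauV0).
  by rewrite (tangent_map_invg hR 1 dtau tau0) Theta_repN.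
by rewrite /cobord0 [_ + hat _ _ _]addrC -addrA opprD addrA subrr add0r opprB.
Qed.

End Deformation.

Theorem proposition3p3 (R : realType) (m n : nat)
    (G : lieGroupType R m) (H : lieGroupType R n)
    (Theta : G -> H -> H) (hTheta : lie_action Theta)
    (D : G -> H) (hD : crossed_hom Theta D)
    (DD : G * R -> H) (hDD : deformation Theta D DD) :
  (forall s : R, cocycle1 Theta (fun a => DD (a, s)) (hat DD s)) /\
  (forall DD' : G * R -> H, deformation Theta D DD' ->
     equivalent_deformations Theta DD DD' ->
     cohomology_class Theta D (hat DD' 0) = cohomology_class Theta D (hat DD 0)
     /\ cohomology1 Theta D (cohomology_class Theta D (hat DD 0))).
Proof.
split=> [s|DD' hDD' eqDD]; first exact: (hat_cocycle hTheta _ hDD).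
split.
  have sub_add_sub (V : zmodType) (x y z : V) : x - z = x - y + (y - z).
    by rewrite addrA subrK.
  have sub_sub_sub (V : zmodType) (x y z : V) : x - y = x - z - (y - z).
    by rewrite opprB addrA subrK.
  have [w hw] := hat_equivalent hTheta hDD hDD' eqDD.
  apply/seteqP; split=> beta [cbeta [u hu]]; split=> //.
    exists (u + w) => a; rewrite cobord0D -hu -hw; exact: sub_add_sub.
  exists (u - w) => a; rewrite cobord0D cobord0N -hu -hw; exact: sub_sub_sub.
exists (hat DD 0) => //.
have -> : D = fun a => DD (a, 0).
  by apply/funext => a; have [_ -> _] := hDD.
exact: (hat_cocycle hTheta _ hDD).
Qed.
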